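(* Let $\sigma$ be a signature, $\Sigma$ a set of $\mathsf{GC}^2$ constraints on $\sigma_{\leq 2}$, $\Phi$ a set of functional dependencies on relations of $\sigma_{>2}$, $\Delta$ a set of single-head frontier-one rules on $\sigma$ that are non-conflicting with respect to $\Phi$, $F(\mathbf{x})$ a $\sigma$-fact, and $q$ a CQ on $\sigma$. Let $\Theta := (\exists \mathbf{x}~F(\mathbf{x})) \wedge \Sigma \wedge \Delta \wedge \neg q$. If there is an interpretation $\mathcal{I}$ satisfying $\Theta$ and a witness $\mathcal{W}$ of $F$ in $\mathcal{I}$ such that $\mathcal{W}$ satisfies $\Phi$, then $\Theta \wedge \Phi$ is satisfiable.
   Context: A signature $\sigma$ is a finite set of relation names with arities; $\sigma_{\leq 2}$ and $\sigma_{>2}$ denote its relations of arity $\leq 2$ and $>2$; $|R|$ is the arity of $R$. Sets of constraints are finite. Atoms use variables only (no constants). A $\sigma$-fact is a finite conjunction of atoms over $\sigma$. A CQ is an existentially quantified finite conjunction of atoms without free variables. Interpretations are relational structures, finite or infinite. A witness $\mathcal{W}$ of $F$ in $\mathcal{I}$ is an interpretation obtained from some variable binding $\mathbf{w}$ with $\mathcal{I} \models F(\mathbf{w})$: it interprets each relation $R$ by the set of tuples of $R^{\mathcal{I}}$ obtained by substituting the $R$-atoms of $F$ according to $\mathbf{w}$ (its domain is the set of elements in $\mathbf{w}$). An existential rule is a sentence $\forall \mathbf{x}~(\phi(\mathbf{x}) \rightarrow \exists \mathbf{y}~\psi(\mathbf{x'},\mathbf{y}))$ with $\mathbf{x'}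 \subseteq \mathbf{x}$, where $\phi$ (body) and $\psi$ (head) are conjunctions of atoms without equality or constants; its frontier is the set $\mathbf{x'}$ of variables occurring in both body and head. It is frontier-one if the frontier has exactly one variable, and single-head if its head is a single atom. A functional dependency (FD) on $R$ is a sentence $\forall \mathbf{x}\mathbf{y}~(R(x_1,\ldots,x_n) \wedge R(y_1,\ldots,y_n) \wedge \bigwedge_{l \in L} x_l = y_l) \rightarrow x_r = y_r$ for some $1 \leq r \leq |R| = n$ and some $L \subseteq \{1,\ldots,|R|\}$, called the determiner of the FD. A single-head rule $\tau$ with head atom $A = R(\mathbf{z})$ is non-conflicting with respect to $\Phi$ if, letting $S$ be the set of $i \in \{1,\ldots,|R|\}$ such that $z_i$ is a frontier variable: (i) no strict subset of $S$ is the determiner of an FD of $\Phi$ on $R$; (ii) if $S$ is exactly the determiner of an FD of $\Phi$ on $R$, then all existentially quantified variables in $A$ occur only once. $\mathsf{GC}^2$ (two-variable guarded fragment with counting) is the smallest class of constant-free first-order formulas with at most two variables that contains all atoms for relations of $\sigma_{\leq 2}$ and is closed under Boolean connectives, under guarded universal and existential quantification (guarded by an atom over $\sigma_{\leq 2}$ containing all free variables of the quantified formula), and under number quantification: if $\phi(x,y)$ is in $\mathsf{GC}^2$ and $A(x,y)$ is an arity-two atom with two free variables, then $\exists^{\geq n} y~A(x,y) \wedge \phi(x,y)$ and $\exists^{<n} y~A(x,y) \wedge \phi(x,y)$ are in $\mathsf{GC}^2$, for every integer $n$. *)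

(* Defs.v *)
From mathcomp Require Import all_boot all_order all_algebra.
From Stdlib Require List.

Set Implicit Arguments.
Unset Strict Implicit.
Unset Printing Implicit Defensive.

Record signature := Signature {
  relname :> finType;
  arity : relname -> nat }.

(** The domain of a [structure] may be empty.  This is needed for witnesses of
    facts in which no variable occurs. *)
Record structure (sg : signature) := Structure {
  dom : Type;
  rel_of : forall R : sg, (arity R).-tuple dom -> Prop }.

Record interpretation (sg : signature) := Interpretation {
  structure_of :> structure sg;
  dom_nonempty : inhabited (dom structure_of) }.

Definition atom (sg : signature) (V : Type) : Type :=
  {R : sg & (arity R).-tuple V}.

Definition atom_args (sg : signature) (V : Type) (A : atom sg V) : seq V :=
  tval (tagged A).

Definition sat_atom (sg : signature) (V : Type) (M : structure sg)
    (e : V -> dom M) (A : atom sg V) : Prop :=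
  rel_of (map_tuple e (tagged A)).

(** A finite conjunction of atoms, over the variables [nat]. *)
Definition conj_atoms (sg : signature) : Type := seq (atom sg nat).

Definition conj_vars (sg : signature) (F : conj_atoms sg) : seq nat :=
  flatten [seq atom_args A | A <- F].

Definition sat_conj (sg : signature) (M : structure sg)
    (e : nat -> dom M) (F : conj_atoms sg) : Prop :=
  forall A, A \in F -> sat_atom e A.

(** The existential closure of a conjunction of atoms: both the sentence
    stating the existence of a match of a fact, and a CQ. *)
Definition sat_exists (sg : signature) (M : structure sg)
    (F : conj_atoms sg) : Prop :=
  exists e : nat -> dom M, sat_conj e F.

Definition witness_structure (sg : signature) (F : conj_atoms sg)
    (M : structure sg) (w : nat -> dom M) : structure sg :=
  @Structure sg {d : dom M | exists2 x, x \in conj_vars F & w x = d}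
    (fun R t => exists2 z : (arity R).-tuple nat,
       Tagged (fun R : sg => (arity R).-tuple nat) z \in F
       & map_tuple w z = map_tuple sval t).

Definition is_witness (sg : signature) (F : conj_atoms sg)
    (M : structure sg) (W : structure sg) : Prop :=
  exists2 w : nat -> dom M, sat_conj w F & W = witness_structure F w.

(** The universally quantified variables are those of the body; the head
    variables that do not occur in the body are existentially quantified. *)
Record rule (sg : signature) := Rule {
  body : conj_atoms sg;
  head : conj_atoms sg }.

Definition frontier (sg : signature) (tau : rule sg) : seq nat :=
  [seq x <- undup (conj_vars (head tau)) | x \in conj_vars (body tau)].

Definition sat_rule (sg : signature) (M : structure sg) (tau : rule sg) :
    Prop :=
  forall e : nat -> dom M, sat_conj e (body tau) ->
  exists e' : nat -> dom M,
    (forall x, x \in frontier tau -> e' x = e x) /\ sat_conj e' (head tau).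

Definition frontier_one (sg : signature) (tau : rule sg) : Prop :=
  size (frontier tau) = 1.

Definition single_head (sg : signature) (tau : rule sg) : Prop :=
  size (head tau) = 1.

(** An FD on [R] is a determiner together with a determined position. *)
Definition fd_on (sg : signature) (R : sg) : Type :=
  ({set 'I_(arity R)} * 'I_(arity R))%type.

Definition fd (sg : signature) : Type := {R : sg & fd_on R}.

Definition sat_fd (sg : signature) (M : structure sg) (f : fd sg) : Prop :=
  let: existT R (L, r) := f in
  forall x y : (arity R).-tuple (dom M),
    rel_of x -> rel_of y -> (forall l, l \in L -> tnth x l = tnth y l) ->
    tnth x r = tnth y r.

Definition sat_fds (sg : signature) (M : structure sg) (Phi : seq (fd sg)) :
    Prop :=
  forall f, f \in Phi -> sat_fd M f.

Definition is_determiner (sg : signature) (Phi : seq (fd sg)) (R : sg)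
    (L : {set 'I_(arity R)}) : Prop :=
  exists r : 'I_(arity R), Tagged (@fd_on sg) (L, r) \in Phi.

Definition frontier_positions (sg : signature) (tau : rule sg)
    (A : atom sg nat) : {set 'I_(arity (tag A))} :=
  [set i | tnth (tagged A) i \in frontier tau].

Definition non_conflicting (sg : signature) (Phi : seq (fd sg))
    (tau : rule sg) : Prop :=
  exists2 A : atom sg nat, head tau = [:: A] &
    let S := frontier_positions tau A in
    (forall L : {set 'I_(arity (tag A))},
       L \proper S -> ~ is_determiner Phi L) /\
    (is_determiner Phi S ->
     forall x, x \in atom_args A -> x \notin frontier tau ->
       count_mem x (atom_args A) = 1).

Inductive formula (sg : signature) : Type :=
| FAtom of atom sg 'I_2
| FNot of formula sg
| FAnd of formula sg & formula sg
| FOr of formula sg & formula sg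
| FImp of formula sg & formula sg
| FEx of 'I_2 & formula sg
| FAll of 'I_2 & formula sg
| FAtLeast of int & 'I_2 & formula sg
| FLess of int & 'I_2 & formula sg.

Definition atom_fv (sg : signature) (A : atom sg 'I_2) : {set 'I_2} :=
  [set x in atom_args A].

Fixpoint fv (sg : signature) (phi : formula sg) : {set 'I_2} :=
  match phi with
  | FAtom A => atom_fv A
  | FNot p => fv p
  | FAnd p1 p2 | FOr p1 p2 | FImp p1 p2 => fv p1 :|: fv p2
  | FEx x p | FAll x p | FAtLeast _ x p | FLess _ x p => fv p :\ x
  end.

Definition update (D : Type) (e : 'I_2 -> D) (x : 'I_2) (d : D) : 'I_2 -> D :=
  fun y => if y == x then d else e y.

(** [P] holds for at least [n] distinct elements; always true if [n <= 0]. *)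
Definition at_least (D : Type) (n : int) (P : D -> Prop) : Prop :=
  exists m : nat, (n <= m%:Z)%R /\
  exists g : 'I_m -> D, injective g /\ forall i, P (g i).

Fixpoint eval (sg : signature) (M : structure sg) (e : 'I_2 -> dom M)
    (phi : formula sg) : Prop :=
  match phi with
  | FAtom A => sat_atom e A
  | FNot p => ~ eval e p
  | FAnd p1 p2 => eval e p1 /\ eval e p2
  | FOr p1 p2 => eval e p1 \/ eval e p2
  | FImp p1 p2 => eval e p1 -> eval e p2
  | FEx x p => exists d, eval (update e x d) p
  | FAll x p => forall d, eval (update e x d) p
  | FAtLeast n x p => at_least n (fun d => eval (update e x d) p)
  | FLess n x p => ~ at_least n (fun d => eval (update e x d) p)
  end.

Definition sat_formula (sg : signature) (M : structure sg)
    (phi : formula sg) : Prop :=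
  forall e : 'I_2 -> dom M, eval e phi.

(** Guarded quantification binds a block [xs] of variables under one guard, so
    that a sentence such as [forall x y, A(x,y) -> phi] is covered. *)
Inductive GC2 (sg : signature) : formula sg -> Prop :=
| GC2_atom A : arity (tag A) <= 2 -> GC2 (FAtom A)
| GC2_not p : GC2 p -> GC2 (FNot p)
| GC2_and p1 p2 : GC2 p1 -> GC2 p2 -> GC2 (FAnd p1 p2)
| GC2_or p1 p2 : GC2 p1 -> GC2 p2 -> GC2 (FOr p1 p2)
| GC2_imp p1 p2 : GC2 p1 -> GC2 p2 -> GC2 (FImp p1 p2)
| GC2_ex (xs : seq 'I_2) A p :
    GC2 p -> arity (tag A) <= 2 -> fv p \subset atom_fv A ->
    GC2 (foldr (@FEx sg) (FAnd (FAtom A) p) xs)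
| GC2_all (xs : seq 'I_2) A p :
    GC2 p -> arity (tag A) <= 2 -> fv p \subset atom_fv A ->
    GC2 (foldr (@FAll sg) (FImp (FAtom A) p) xs)
| GC2_at_least n y A p :
    GC2 p -> arity (tag A) = 2 -> atom_fv A = [set: 'I_2] ->
    GC2 (FAtLeast n y (FAnd (FAtom A) p))
| GC2_less n y A p :
    GC2 p -> arity (tag A) = 2 -> atom_fv A = [set: 'I_2] ->
    GC2 (FLess n y (FAnd (FAtom A) p)).

Definition GC2_constraint (sg : signature) (phi : formula sg) : Prop :=
  GC2 phi /\ fv phi = set0.

Definition sat_theta (sg : signature) (Sigma : seq (formula sg))
    (Delta : seq (rule sg)) (F q : conj_atoms sg) (M : interpretation sg) :
    Prop :=
  [/\ sat_exists M F,
      forall phi, List.In phi Sigma -> sat_formula M phi,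
      forall tau, List.In tau Delta -> sat_rule M tau
    & ~ sat_exists M q].

(* Main.v *)
(** Take infinitely many disjoint copies of the model, with the relations of
    arity at most two; GC^2 sentences only see one copy at a time, so they are
    preserved.  For relations of higher arity, put the facts of the witness in
    a root copy, and, whenever the head of a rule is satisfied in the model at
    the projection of an element, create one head fact at this element whose
    other positions lie in brand-new copies, one for each variable.  A created
    fact shares at most one element with any other fact, and this element is at
    the frontier positions of one of the two; by non-conflictingness, an FD can
    only be triggered when its determiner is exactly the set of these
    positions.  In that case no fact is created if the element already occurs
    at these positions, and otherwise a single one is created for all rules
    with these positions; this suffices because their existential head
    variables occur only once.  Projection to the original model is a
    homomorphism, so the query stays false, and a rule body matched at an
    element is also matched at its projection. *)
Require Import Defs.
From mathcomp Require Import all_boot all_order all_algebra.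
From Stdlib Require List.
From Stdlib Require Import Classical ClassicalEpsilon FunctionalExtensionality.

Set Implicit Arguments.
Unset Strict Implicit.
Unset Printing Implicit Defensive.

(** * Dependent pairs, tuples and first occurrences *)

Local Notation mk_atom z := (Tagged (fun R => (arity R).-tuple _) z).

Lemma Tagged_inj (I : eqType) (T_ : I -> Type) (i : I) (x y : T_ i) :
  Tagged T_ x = Tagged T_ y -> x = y.
Proof. by move/(congr1 (tagged_as (Tagged T_ x))); rewrite !tagged_asE. Qed.

Lemma singleton_atom_inj (sg : signature) (V : Type) (R : sg)
    (z y : (arity R).-tuple V) :
  [:: mk_atom z : atom sg V] = [:: mk_atom y : atom sg V] -> z = y.
Proof.
move/(congr1 (seq.head (mk_atom z : atom sg V))).
exact: (@Tagged_inj sg (fun R => (arity R).-tuple V)). Qed.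

Lemma singleton_atom_tag (sg : signature) (V : Type) (R R' : sg)
    (z : (arity R).-tuple V) (y : (arity R').-tuple V) :
  [:: mk_atom z : atom sg V] = [:: mk_atom y : atom sg V] -> R = R'.
Proof. by move/(congr1 (fun s => tag (seq.head (mk_atom z : atom sg V) s))). Qed.

Lemma map_tuple_eq (n : nat) (A B : Type) (f f' : A -> B) (t : n.-tuple A) :
  f =1 f' -> map_tuple f t = map_tuple f' t.
Proof. by move=> e; apply: val_inj; apply: eq_map. Qed.

Lemma map_tuple_comp (n : nat) (A B C : Type) (f : B -> C) (g : A -> B)
    (t : n.-tuple A) :
  map_tuple f (map_tuple g t) = map_tuple (f \o g) t.
Proof. by apply: val_inj; rewrite /= map_comp. Qed.

Lemma index_nth_count1 (T : eqType) (x0 : T) (s : seq T) (i : nat) :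
  i < size s -> count_mem (nth x0 s i) s = 1 -> index (nth x0 s i) s = i.
Proof.
elim: s i => [|a s IHs] [|i] //=; first by rewrite eqxx.
rewrite ltnS => lt_i; have s_i := mem_nth x0 lt_i.
case: eqVneq => [_ [c0]|_]; last by rewrite add0n => /IHs->.
by move: s_i; rewrite -has_pred1 has_count -[count _ _]add0n c0.
Qed.

(** * Frontier positions and determiners of frontier-one rules *)

Section Rules.
Variables (sg : signature) (Phi : seq (fd sg)).

Definition frontier_var (tau : rule sg) : nat := nth 0 (frontier tau) 0.

(** A dependent pair, so that keys of rules with different head relations can be compared. *)
Definition rule_key (tau : rule sg) : option {R : sg & {set 'I_(arity R)}} :=
  if Defs.head tau is [:: A]
  then Some (Tagged (fun R : sg => {set 'I_(arity R)})
                    (frontier_positions tau A))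
  else None.

Definition determined (tau : rule sg) : Prop :=
  exists2 A, Defs.head tau = [:: A] &
    is_determiner Phi (frontier_positions tau A).

Lemma mem_frontier (tau : rule sg) x :
  frontier_one tau -> (x \in frontier tau) = (x == frontier_var tau).
Proof.
rewrite /frontier_one /frontier_var.
by case: (frontier tau) => [|y []] //= _; rewrite inE.
Qed.

Lemma frontier_var_in_head (tau : rule sg) (R : sg) (z : (arity R).-tuple nat) :
  frontier_one tau -> Defs.head tau = [:: mk_atom z] ->
  exists i, tnth z i = frontier_var tau.
Proof.
move=> t1 hz; have := mem_frontier (frontier_var tau) t1.
rewrite eqxx mem_filter mem_undup hz /conj_vars /= cats0 => /andP[_].
by move=> /tnthP[i ->]; exists i.
Qed.

Lemma frontier_positionsE (tau : rule sg) (R : sg) (z : (arity R).-tuple nat) :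
  frontier_one tau ->
  frontier_positions tau (mk_atom z) = [set i | tnth z i == frontier_var tau].
Proof. by move=> t1; apply/setP => i; rewrite !inE mem_frontier. Qed.

(** [L] lies within the frontier positions, and the first clause of [non_conflicting] excludes a
    strict inclusion. *)
Lemma determiner_frontier (tau : rule sg) (R : sg) (z : (arity R).-tuple nat)
    (L : {set 'I_(arity R)}) :
  frontier_one tau -> non_conflicting Phi tau ->
  Defs.head tau = [:: mk_atom z] ->
  is_determiner Phi L -> (forall l, l \in L -> tnth z l = frontier_var tau) ->
  L = [set i | tnth z i == frontier_var tau] /\ determined tau.
Proof.
move=> t1 [A hA [notdet _]] hz detL subL; move: hA notdet.
rewrite hz => -[<-] {A} notdet.
have LS : L \subset frontier_positions tau (mk_atom z).
  by rewrite frontier_positionsE //; apply/subsetP => l /subL e; rewrite inE e.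
move: LS; rewrite subEproper => /orP[/eqP eLS|/notdet/(_ detL)//].
split; first by rewrite eLS frontier_positionsE.
by exists (mk_atom z); rewrite -?eLS.
Qed.

(** By the second clause of [non_conflicting], an existential variable occurs once in the head and
    so identifies its position. *)
Lemma determined_index (tau : rule sg) (R : sg) (z : (arity R).-tuple nat) i :
  frontier_one tau -> non_conflicting Phi tau ->
  Defs.head tau = [:: mk_atom z] ->
  determined tau -> tnth z i != frontier_var tau -> index (tnth z i) z = i.
Proof.
move=> t1 [A hA [_ uz]] hz [B hB detB] ni; move: hA hB uz detB.
rewrite hz => -[<-] [<-] {A B} uz /uz /(_ (tnth z i)).
rewrite /atom_args /= mem_tnth mem_frontier // => /(_ isT ni).
by rewrite (tnth_nth 0) => /index_nth_count1->; rewrite ?size_tuple.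
Qed.

End Rules.

(** * Blocks of quantifiers *)

Section Blocks.
Variables (sg : signature) (M : structure sg).

Lemma eval_exists_block (xs : seq 'I_2) (phi : formula sg) (e : 'I_2 -> dom M) :
  eval e (foldr (@FEx sg) phi xs) <->
  exists e', (forall x, x \notin xs -> e' x = e x) /\ eval e' phi.
Proof.
elim: xs e => [|x xs IHxs] e /=.
  split=> [ev|[e' [/(_ _ isT) ee' ev]]]; first by exists e.
  by rewrite -(functional_extensionality _ _ ee').
split=> [[d /IHxs[e' [ee' ev]]]|[e' [ee' ev]]].
  exists e'; split=> // y; rewrite inE negb_or => /andP[ny /ee'->].
  by rewrite /update (negbTE ny).
exists (e' x); apply/IHxs; exists e'; split=> // y y_xs; rewrite /update.
by case: eqVneq => [->//|nyx]; apply: ee'; rewrite inE negb_or nyx.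
Qed.

Lemma eval_forall_block (xs : seq 'I_2) (phi : formula sg) (e : 'I_2 -> dom M) :
  eval e (foldr (@FAll sg) phi xs) <-> ~ eval e (foldr (@FEx sg) (FNot phi) xs).
Proof.
elim: xs e => [|x xs IHxs] e /=; first by split=> [ev /(_ ev)|/NNPP].
split=> [all_ev [d ev]|no_ev d]; first by move/IHxs: (all_ev d).
by apply/IHxs => ev; apply: no_ev; exists d.
Qed.

Lemma fv_exists_block (xs : seq 'I_2) (phi : formula sg) x :
  x \in fv phi -> x \notin xs -> x \in fv (foldr (@FEx sg) phi xs).
Proof.
move=> x_phi; elim: xs => //= y xs IHxs.
by rewrite inE negb_or => /andP[nxy /IHxs x_xs]; rewrite in_setD1 nxy.
Qed.

Lemma fv_forall_block (xs : seq 'I_2) (phi : formula sg) :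
  fv (foldr (@FAll sg) phi xs) = fv (foldr (@FEx sg) (FNot phi) xs).
Proof. by elim: xs => //= y xs ->. Qed.

Lemma fv_exists_block_eq (xs : seq 'I_2) (phi psi : formula sg) :
  fv phi = fv psi -> fv (foldr (@FEx sg) phi xs) = fv (foldr (@FEx sg) psi xs).
Proof. by move=> e; elim: xs => //= y xs ->. Qed.

End Blocks.

(** * The unravelling *)

Section Unravelling.
Variables (sg : signature) (Phi : seq (fd sg)) (Delta : seq (rule sg)).
Variables (F : conj_atoms sg) (M : interpretation sg) (w : nat -> dom M).

Definition generator : Type := rule sg * (nat -> dom M).

Definition origin (g : generator) : dom M := g.2 (frontier_var g.1).

(** A copy is named by its path: [(g, v) :: k] is the copy created for the head
    variable [v] of the generator [g] applied in copy [k]. *)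
Definition copy : Type := seq (generator * nat).

Definition place (g : generator) (k : copy) (v : nat) : dom M * copy :=
  if v == frontier_var g.1 then (g.2 v, k) else (g.2 v, (g, v) :: k).

(** The binding is meant to be one that satisfaction of a rule in [M] provides, which is only known
    to match the head. *)
Definition applicable (g : generator) : Prop :=
  List.In g.1 Delta /\ sat_conj g.2 (Defs.head g.1).

Lemma generator_inhabited : inhabited generator.
Proof. by case: (dom_nonempty M) => d; split; exact: (Rule [::] [::], fun=> d).
Qed.

(* The same choice for all rules whose heads have the same relation and frontier
   positions, so that they share one fact. *)
Definition canonical (key : option {R : sg & {set 'I_(arity R)}}) (a : dom M) :
    generator :=
  epsilon generator_inhabited
    (fun g => [/\ applicable g, rule_key g.1 = key & origin g = a]).

Definition selected (g : generator) : Prop :=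
  applicable g /\
  (determined Phi g.1 -> g = canonical (rule_key g.1) (origin g)).

Definition seed_fact (R : sg) (t : (arity R).-tuple (dom M * copy)) : Prop :=
  exists2 z, mk_atom z \in F & t = map_tuple (fun v => (w v, [::])) z.

Definition head_fact (g : generator) (k : copy) (R : sg)
    (t : (arity R).-tuple (dom M * copy)) : Prop :=
  exists2 z, Defs.head g.1 = [:: mk_atom z] & t = map_tuple (place g k) z.

(** When the rule of [g] is determined, such a fact can serve as its head fact at the element
    [(origin g, k)]. *)
Definition covers (g : generator) (k : copy) (R : sg)
    (t : (arity R).-tuple (dom M * copy)) : Prop :=
  exists2 z : (arity R).-tuple nat, Defs.head g.1 = [:: mk_atom z] &
    forall i, tnth z i = frontier_var g.1 -> tnth t i = (origin g, k).

(* The facts in the match are the only ones, besides those created at the origin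
   of [g] in copy [k] itself, in which that element can occur. *)
Fixpoint active (k : copy) (g : generator) {struct k} : Prop :=
  selected g /\
  (determined Phi g.1 ->
   ~ exists (R : sg) (t : (arity R).-tuple (dom M * copy)),
       covers g k t /\
       match k with
       | [::] => seed_fact t
       | (g', _) :: k' => active k' g' /\ head_fact g' k' t
       end).

(** The match of [active] under a name; there it is written out because it contains the recursive
    call. *)
Definition parent_fact (k : copy) (R : sg)
    (t : (arity R).-tuple (dom M * copy)) : Prop :=
  match k with
  | [::] => seed_fact t
  | (g', _) :: k' => active k' g' /\ head_fact g' k' t
  end.

Lemma activeE k g :
  active k g <->
  selected g /\
  (determined Phi g.1 ->
   ~ exists (R : sg) (t : (arity R).-tuple (dom M * copy)),
       covers g k t /\ parent_fact k t).
Proof. by case: k => [|[g' v] k]. Qed.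

Definition high_rel (R : sg) (t : (arity R).-tuple (dom M * copy)) : Prop :=
  seed_fact t \/ exists k g, active k g /\ head_fact g k t.

Definition unravelled_rel (R : sg) (t : (arity R).-tuple (dom M * copy)) :
    Prop :=
  if arity R <= 2
  then exists k t0, rel_of t0 /\ t = map_tuple (fun d : dom M => (d, k)) t0
  else high_rel t.

Lemma unravelled_nonempty : inhabited (dom M * copy).
Proof. by case: (dom_nonempty M) => d; split; exact: (d, [::]). Qed.

Definition unravelling : interpretation sg :=
  @Interpretation sg (Structure unravelled_rel) unravelled_nonempty.

Lemma parent_fact_rel k (R : sg) (t : (arity R).-tuple (dom M * copy)) :
  parent_fact k t -> high_rel t.
Proof.
case: k => [|[g v] k] /=; first by left.
by move=> [ag hg]; right; exists k, g.
Qed.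

(** * Projection to the model as a homomorphism *)

Section Homomorphism.
Hypothesis satF : sat_conj w F.

Lemma place_fst g k v : (place g k v).1 = g.2 v.
Proof. by rewrite /place; case: ifP. Qed.

Lemma active_applicable k g : active k g -> applicable g.
Proof. by move/activeE => [[]]. Qed.

Lemma unravelling_proj (R : sg) (t : (arity R).-tuple (dom M * copy)) :
  unravelled_rel t -> rel_of (map_tuple fst t).
Proof.
rewrite /unravelled_rel; case: ifP => _.
  move=> [k [t0 [r ->]]]; rewrite map_tuple_comp.
  suff -> : map_tuple (fst \o (fun d : dom M => (d, k))) t0 = t0 by [].
  by apply: val_inj; apply: map_id.
move=> [[z Fz ->]|[k [g [/active_applicable[_ sat_g] [z hz ->]]]]].
  by rewrite map_tuple_comp; apply: (satF Fz).
rewrite map_tuple_comp (@map_tuple_eq _ _ _ _ g.2); last exact: place_fst.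
by apply: (sat_g (mk_atom z)); rewrite hz inE.
Qed.

Lemma sat_conj_proj (e : nat -> dom unravelling) (G : conj_atoms sg) :
  sat_conj e G -> sat_conj (M := M) (fun v => (e v).1) G.
Proof.
move=> sat_e A /sat_e /unravelling_proj.
by rewrite map_tuple_comp.
Qed.

Lemma sat_seed : sat_conj (M := unravelling) (fun v => (w v, [::])) F.
Proof.
move=> [R z] Fz; rewrite /sat_atom /= /unravelled_rel; case: ifP => _.
  exists [::], (map_tuple w z); split; first exact: (satF Fz).
  by rewrite map_tuple_comp.
by left; exists z.
Qed.

End Homomorphism.

(** * Functional dependencies, then rules, in the unravelling *)

Section FDs.
Hypothesis hDelta : forall tau, List.In tau Delta ->
  [/\ single_head tau, frontier_one tau & non_conflicting Phi tau].
Hypothesis hW : sat_fds (witness_structure F w) Phi.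

Lemma active_rule k g : active k g ->
  frontier_one g.1 /\ non_conflicting Phi g.1.
Proof. by move/active_applicable => [/hDelta[]]. Qed.

(** Such an [L] is exactly the set of frontier positions, so the rule is determined and [u] covers
    [g] in [k]; then [g] would not be active. *)
Lemma no_parent_conflict k g (R : sg) (t u : (arity R).-tuple (dom M * copy))
    (z : (arity R).-tuple nat) (L : {set 'I_(arity R)}) :
  active k g -> Defs.head g.1 = [:: mk_atom z] -> t = map_tuple (place g k) z ->
  parent_fact k u -> is_determiner Phi L ->
  (forall l, l \in L -> tnth t l = tnth u l) ->
  (forall l, l \in L -> tnth z l = frontier_var g.1) -> False.
Proof.
move=> ag hz et pu detL agree Lfr; have [g1 nc] := active_rule ag.
have [eL det] := determiner_frontier g1 nc hz detL Lfr.
move/activeE: ag => [_ /(_ det)]; apply; exists R, u; split=> //.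
exists z => // i ei; rewrite -agree; last by rewrite eL inE ei.
by rewrite et tnth_map ei /place eqxx.
Qed.

(** The frontier variable occurs in the head, so the empty set is a strict subset of the frontier
    positions. *)
Lemma not_determiner0 k g (R : sg) (z : (arity R).-tuple nat) :
  active k g -> Defs.head g.1 = [:: mk_atom z] ->
  ~ is_determiner Phi (set0 : {set 'I_(arity R)}).
Proof.
move=> ag hz det0; have [g1 nc] := active_rule ag.
have [] := determiner_frontier g1 nc hz det0; first by move=> l; rewrite inE.
have [i ei] := frontier_var_in_head g1 hz.
by move/setP/(_ i); rewrite !inE ei eqxx.
Qed.

Lemma seed_seed_fd (R : sg) (L : {set 'I_(arity R)}) r
    (t u : (arity R).-tuple (dom M * copy)) :
  Tagged (@fd_on sg) (L, r) \in Phi -> seed_fact t -> seed_fact u ->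
  (forall l, l \in L -> tnth t l = tnth u l) -> tnth t r = tnth u r.
Proof.
move=> fPhi [z Fz ->] [y Fy ->] agree; have /= := hW fPhi.
have inW (x : (arity R).-tuple nat) : mk_atom x \in F ->
    exists2 s : (arity R).-tuple (dom (witness_structure F w)),
      rel_of s & forall i, sval (tnth s i) = w (tnth x i).
  move=> Fx.
  have xF i : exists2 v, v \in conj_vars F & w v = w (tnth x i).
    exists (tnth x i) => //; apply/flatten_mapP.
    by exists (mk_atom x) => //; apply: mem_tnth.
  pose P d := exists2 v, v \in conj_vars F & w v = d.
  pose s := [tuple (exist P _ (xF i)) | i < arity R].
  have es i : sval (tnth s i) = w (tnth x i) by rewrite /s tnth_mktuple.
  by exists s => //; exists x => //; apply: eq_from_tnth => i;
    rewrite [LHS]tnth_map [RHS]tnth_map es.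
have [s rs es] := inW _ Fz; have [s' rs' es'] := inW _ Fy.
move=> /(_ s s' rs rs') H.
rewrite !tnth_map -es -es' H // => l /agree; rewrite !tnth_map -es -es' => -[].
(* Elements of the witness carry proofs; equal values give equal elements by proof irrelevance. *)
move: (tnth s l) (tnth s' l) => [a pa] [b pb] /= e.
by case: _ / e in pb *; congr exist; apply: proof_irrelevance.
Qed.

(** Non-frontier positions of [t] lie outside the root copy, where all of [u] lies. Agreement on [L]
    forces [k] to be the root and [L] to consist of frontier positions, with [u] a parent fact. *)
Lemma seed_head_fd (R : sg) (L : {set 'I_(arity R)}) k g
    (t u : (arity R).-tuple (dom M * copy)) :
  is_determiner Phi L -> seed_fact u -> active k g -> head_fact g k t ->
  ~ (forall l, l \in L -> tnth t l = tnth u l).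
Proof.
move=> detL su ag [z hz et] agree.
have shape l : l \in L -> k = [::] /\ tnth z l = frontier_var g.1.
  move=> /agree; case: su => y _ ->; rewrite et !tnth_map /place.
  by case: eqP => // e [_ ->].
case: (set_0Vmem L) => [L0|[l Ll]].
  by move: detL; rewrite L0; apply: not_determiner0 ag hz.
apply: (no_parent_conflict ag hz et _ detL agree) => [|i /shape[]//].
by have [-> _] := shape l Ll.
Qed.

Lemma head_head_fd (R : sg) (L : {set 'I_(arity R)}) k g k' g'
    (t u : (arity R).-tuple (dom M * copy)) :
  is_determiner Phi L -> active k g -> head_fact g k t ->
  active k' g' -> head_fact g' k' u ->
  (forall l, l \in L -> tnth t l = tnth u l) -> t = u.
Proof.
move=> detL ag [z hz et] ag' [y hy eu] agree.
have same : g = g' -> k = k' -> t = u.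
  move=> eg ek; by move: hy eu; rewrite -eg -ek hz => /singleton_atom_inj <- ->.
have ne (kk : copy) p : kk <> p :: kk.
  by move=> /(congr1 size)/eqP; rewrite /= ltn_eqF.
have ne2 (kk : copy) p p' : kk <> p :: p' :: kk.
  by move=> /(congr1 size)/eqP; rewrite /= ltn_eqF.
case: (set_0Vmem L) => [L0|[l0 Ll0]].
  by move: detL; rewrite L0 => /(not_determiner0 ag hz).
(* A shared element is the frontier element of both facts, or the frontier element of one and new in
   the other, or new in both and then created by the same generator in the same copy. *)
have cases l : l \in L ->
   [\/ [/\ k = k', origin g = origin g', tnth z l = frontier_var g.1 &
           tnth y l = frontier_var g'.1],
       tnth z l = frontier_var g.1 /\ (exists v, k = (g', v) :: k'),
       tnth y l = frontier_var g'.1 /\ (exists v, k' = (g, v) :: k) |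
       g = g' /\ k = k'].
  move=> /agree; rewrite et eu !tnth_map /place /origin.
  case: eqP => [->|_]; case: eqP => [->|_].
  - by case=> -> ->; constructor 1.
  - by case=> _ ->; constructor 2; split=> //; eexists.
  - by case=> _ <-; constructor 3; split=> //; eexists.
  - by case=> _ -> _ ->; constructor 4.
case: (cases l0 Ll0) => [[ek eo _ _]|[_ [v ek]]|[_ [v ek]]|[]//].
- apply: NNPP => neq.
  have both l : l \in L ->
      tnth z l = frontier_var g.1 /\ tnth y l = frontier_var g'.1.
    move=> /cases[[]//|[_ [v]]|[_ [v]]|[eg _]].
    + by rewrite ek => /ne.
    + by rewrite ek => /ne.
    + by case: neq; apply: same.
  have [g1 nc] := active_rule ag; have [g1' nc'] := active_rule ag'.
  have [eL det] := determiner_frontier g1 nc hz detL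
    (fun l Ll => proj1 (both l Ll)).
  have [eL' det'] := determiner_frontier g1' nc' hy detL
    (fun l Ll => proj2 (both l Ll)).
  (* Both generators are the canonical one for the same key and origin. *)
  case: neq; apply: same => //.
  move/activeE: ag => [[_ /(_ det) ->] _].
  move/activeE: ag' => [[_ /(_ det') ->] _].
  by rewrite eo /rule_key hz hy !frontier_positionsE // -eL -eL'.
(* The copy [k] was created along with the fact [u], which is thus a parent fact; the lengths of the
   paths rule out the other cases. *)
- exfalso; apply: (no_parent_conflict ag hz et (u := u) _ detL agree).
    by rewrite ek /=; split=> //; exists y.
  move=> l /cases[[e]|[]//|[_ [v' e]]|[_ e]]; move: ek.
  + by rewrite e => /ne.
  + by rewrite e => /ne2.
  + by rewrite e => /ne.
- exfalso; apply: (no_parent_conflict ag' hy eu (u := t) _ detL).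
  + by rewrite ek /=; split=> //; exists z.
  + by move=> l /agree.
  move=> l /cases[[e]|[_ [v' e]]|[]//|[_ e]]; move: ek.
  + by rewrite e => /ne.
  + by rewrite e => /ne2.
  + by rewrite e => /ne.
Qed.

Lemma unravelling_fds :
  (forall f, f \in Phi -> 2 < arity (tag f)) -> sat_fds unravelling Phi.
Proof.
move=> hPhi [R [L r]] fPhi t u /=; have /= lt2 := hPhi _ fPhi.
rewrite /unravelled_rel leqNgt lt2 /= => rt ru agree.
have detL : is_determiner Phi L by exists r.
case: rt ru => [st|[k [g [ag ht]]]] [su|[k' [g' [ag' hu]]]].
- exact: (seed_seed_fd fPhi st su agree).
- by case: (seed_head_fd detL st ag' hu) => l /agree.
- by case: (seed_head_fd detL su ag ht).
- by rewrite (head_head_fd detL ag ht ag' hu agree).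
Qed.

(** The canonical generator with the same key and origin either is active, and its own fact covers,
    or is blocked by a parent fact that covers. *)
Lemma determined_covered (tau : rule sg) (e : nat -> dom M) k :
  applicable (tau, e) -> determined Phi tau ->
  exists (R : sg) (t : (arity R).-tuple (dom M * copy)),
    covers (tau, e) k t /\ high_rel t.
Proof.
move=> app det; set g := canonical (rule_key tau) (origin (tau, e)).
have [gapp gkey gorig] : [/\ applicable g, rule_key g.1 = rule_key tau &
    origin g = origin (tau, e)].
  apply: (epsilon_spec generator_inhabited (fun g => [/\ applicable g,
    rule_key g.1 = rule_key tau & origin g = origin (tau, e)])).
  by exists (tau, e).
have [_ t1 _] := hDelta app.1; have [_ g1 _] := hDelta gapp.1.
case: (det) => -[R z] hz detz.
have [z' hz' ez] : exists2 z' : (arity R).-tuple nat,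
    Defs.head g.1 = [:: mk_atom z'] &
    forall i, (tnth z i == frontier_var tau) = (tnth z' i == frontier_var g.1).
  move: gkey; rewrite /rule_key hz.
  case hg: (Defs.head g.1) => [|[R' z'] [|//]] // /Some_inj key_eq.
  have /= eR := congr1 tag key_eq; subst R'; exists z' => //.
  move: key_eq => /(@Tagged_inj sg (fun R => {set 'I_(arity R)})).
  rewrite !frontier_positionsE //.
  by move=> /setP eS i; have := eS i; rewrite !inE.
have detg : determined Phi g.1.
  exists (mk_atom z') => //; move: detz; rewrite !frontier_positionsE //.
  by congr is_determiner; apply/setP => i; rewrite !inE.
have coverg (t : (arity R).-tuple (dom M * copy)) :
    (forall i, tnth z' i = frontier_var g.1 -> tnth t i = (origin g, k)) ->
    covers (tau, e) k t.
  move=> H; exists z => // i /eqP; rewrite /= ez => /eqP /H ->.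
  congr pair; exact: gorig.
have selg : selected g by split=> // _; rewrite gkey gorig.
case: (classic (active k g)) => [ag|nag].
  exists R, (map_tuple (place g k) z'); split.
    by apply: coverg => i ei; rewrite tnth_map ei /place eqxx.
  by right; exists k, g; split=> //; exists z'.
have /NNPP[R' [t [[y hy cy] pt]]] :
    ~ ~ exists (R : sg) (t : (arity R).-tuple (dom M * copy)),
      covers g k t /\ parent_fact k t.
  by move=> no; apply: nag; apply/activeE.
move: hy; rewrite hz' => hy; have eR := singleton_atom_tag hy; subst R'.
have ey := singleton_atom_inj hy.
exists R, t; split; last exact: parent_fact_rel pt.
by apply: coverg; rewrite ey.
Qed.

Lemma unravelling_rule (tau : rule sg) :
  sat_conj w F -> List.In tau Delta -> sat_rule M tau ->
  sat_rule unravelling tau.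
Proof.
move=> satF Dtau sat_tau e sat_e.
have [e' [fr_e' sat_e']] := sat_tau _ (sat_conj_proj satF sat_e).
have [_ t1 nc] := hDelta Dtau.
have {}fr_e' : e' (frontier_var tau) = (e (frontier_var tau)).1.
  by apply: fr_e'; rewrite mem_frontier.
set k := (e (frontier_var tau)).2.
have [[R z] hz _] := nc.
(* With a single frontier variable, it suffices to fix its value and to satisfy the head atom. *)
have fin (e'' : nat -> dom unravelling) :
    e'' (frontier_var tau) = (e' (frontier_var tau), k) ->
    unravelled_rel (map_tuple e'' z) ->
    exists e'' : nat -> dom unravelling,
    (forall x, x \in frontier tau -> e'' x = e x) /\
    sat_conj e'' (Defs.head tau).
  move=> ee'' re''; exists e''; split.
    move=> x; rewrite mem_frontier // => /eqP->.
    by rewrite ee'' fr_e' -surjective_pairing.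
  by move=> A; rewrite hz inE => /eqP->.
case: (leqP (arity R) 2) => [le2|gt2].
  apply: (fin (fun v => (e' v, k))) => //; rewrite /unravelled_rel le2.
  exists k, (map_tuple e' z); rewrite map_tuple_comp; split=> //.
  by apply: (sat_e' (mk_atom z)); rewrite hz inE.
have app : applicable (tau, e') by [].
(* A rule that is not determined is never blocked, so its own head fact is created. *)
case: (classic (determined Phi tau)) => [det|ndet]; last first.
  apply: (fin (place (tau, e') k)); first by rewrite /place /= eqxx.
  rewrite /unravelled_rel leqNgt gt2 /=; right; exists k, (tau, e').
  by split; [apply/activeE; split=> // | exists z].
have [R' [t [[y hy cy] rt]]] := determined_covered k app det.
rewrite /= hz in hy; have eR := singleton_atom_tag hy; subst R'.
have ey := singleton_atom_inj hy; subst y.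
(* Each existential variable is read off the covering fact at its first occurrence in [z]; the
   default is reached only by variables outside [z]. *)
pose e'' v : dom unravelling := if v == frontier_var tau then (e' v, k)
                 else nth (e' v, k) t (index v z).
apply: (fin e''); first by rewrite /e'' eqxx.
suff -> : map_tuple e'' z = t by rewrite /unravelled_rel leqNgt gt2.
apply: eq_from_tnth => i; rewrite tnth_map /e''; case: eqP => [ei|/eqP ni].
  by rewrite cy // ei.
by rewrite (determined_index t1 nc hz det ni) -tnth_nth.
Qed.

End FDs.

(** * Preservation of $\mathsf{GC}^2$ formulas *)

Section Formulas.

(** Only the free variables are tied to the copy [k], so a closed subformula can be evaluated in any
    copy. *)
Definition transfers (phi : formula sg) : Prop :=
  forall (e : 'I_2 -> dom unravelling) (e0 : 'I_2 -> dom M) (k : copy),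
    (forall x, x \in fv phi -> e x = (e0 x, k)) -> eval e phi <-> eval e0 phi.

Lemma sat_low_atom (e : 'I_2 -> dom unravelling) (A : atom sg 'I_2) :
  arity (tag A) <= 2 ->
  sat_atom e A <->
  sat_atom (M := M) (fun x => (e x).1) A /\
  exists k, forall x, x \in atom_fv A -> (e x).2 = k.
Proof.
case: A => R z /= le2; rewrite /sat_atom /= /unravelled_rel le2; split.
  move=> [k [t [rt et]]].
  have ez i : e (tnth z i) = (tnth t i, k).
    by have := f_equal (fun s : (arity R).-tuple _ => tnth s i) et;
      rewrite !tnth_map.
  split; last by exists k => x; rewrite inE => /tnthP[i /= ->]; rewrite ez.
  suff -> : map_tuple (fun x => (e x).1) z = t by [].
  by apply: eq_from_tnth => i; rewrite tnth_map ez.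
move=> [rz [k ek]]; exists k, (map_tuple (fun x => (e x).1) z); split=> //.
apply: eq_from_tnth => i; rewrite !tnth_map.
rewrite -(ek (tnth z i)) -?surjective_pairing //.
by rewrite inE mem_tnth.
Qed.

Lemma transfers_low_atom (A : atom sg 'I_2) :
  arity (tag A) <= 2 -> transfers (FAtom A).
Proof.
move=> le2 e e0 k ee0; apply: (iff_trans (sat_low_atom e le2)).
have -> : sat_atom (M := M) (fun x => (e x).1) A <-> sat_atom e0 A.
  case: A le2 ee0 => R z /= _ ee0; rewrite /sat_atom /=.
  suff -> : map_tuple (fun x => (e x).1) z = map_tuple e0 z by [].
  by apply: eq_from_tnth => i; rewrite !tnth_map ee0 // inE mem_tnth.
by split=> [[]|] // sA; split=> //; exists k => x /ee0->.
Qed.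

Lemma transfers_not (p : formula sg) : transfers p -> transfers (FNot p).
Proof. by move=> tp e e0 k /tp /= ->. Qed.

(** The guard confines its variables, hence the free variables of [p], to one copy. *)
Lemma transfers_exists_block (xs : seq 'I_2) A (p : formula sg) :
  transfers p -> arity (tag A) <= 2 -> fv p \subset atom_fv A ->
  transfers (foldr (@FEx sg) (FAnd (FAtom A) p) xs).
Proof.
move=> tp le2 /subsetP fvp e e0 k ee0; rewrite !eval_exists_block.
have fvA x : x \in atom_fv A -> x \notin xs -> e x = (e0 x, k).
  by move=> xA x_xs; apply: ee0; apply: fv_exists_block => //=; rewrite inE xA.
have tA := transfers_low_atom le2.
split=> -[e' [ee' [sA sp]]].
  (* The copy [k'] may differ from [k] when all variables of the guard are in [xs]. *)
  have [_ [k' ek']] := (sat_low_atom e' le2).1 sA.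
  pose f x := if x \in xs then (e' x).1 else e0 x.
  have e'f x : x \in atom_fv A -> e' x = (f x, k').
    move=> xA; rewrite -(ek' x xA) /f; case: ifPn => [_|x_xs].
      exact: surjective_pairing.
    by rewrite ee' // fvA.
  exists f; split; first by move=> x /negbTE x_xs; rewrite /f x_xs.
  by split; [exact: (tA e' f k' e'f).1 |
             apply: (tp e' f k' _).1 => // x /fvp /e'f].
pose f x : dom unravelling := if x \in xs then (e' x, k) else e x.
have fe' x : x \in atom_fv A -> f x = (e' x, k).
  by move=> xA; rewrite /f; case: ifPn => // x_xs; rewrite fvA // ee'.
exists f; split; first by move=> x /negbTE x_xs; rewrite /f x_xs.
by split; [exact: (tA f e' k fe').2 | apply: (tp f e' k _).2 => // x /fvp /fe'].
Qed.

Lemma transfers_forall_block (xs : seq 'I_2) A (p : formula sg) :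
  transfers p -> arity (tag A) <= 2 -> fv p \subset atom_fv A ->
  transfers (foldr (@FAll sg) (FImp (FAtom A) p) xs).
Proof.
move=> tp le2 fvp e e0 k; rewrite fv_forall_block !eval_forall_block.
have block (N : structure sg) (f : 'I_2 -> dom N) :
    eval f (foldr (@FEx sg) (FNot (FImp (FAtom A) p)) xs) <->
    eval f (foldr (@FEx sg) (FAnd (FAtom A) (FNot p)) xs).
  rewrite !eval_exists_block.
  by split=> -[f' [ff' /= H]]; exists f'; split=> //; tauto.
rewrite !block (@fv_exists_block_eq _ _ _ (FAnd (FAtom A) (FNot p))) // => ee0.
by rewrite (transfers_exists_block (transfers_not tp) le2 fvp ee0).
Qed.

(** The guard contains the other variable, whose value lies in copy [k]. All counted elements
    therefore lie in [k], where projection is injective. *)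
Lemma transfers_at_least n y A (p : formula sg) :
  transfers p -> arity (tag A) = 2 -> atom_fv A = [set: 'I_2] ->
  transfers (FAtLeast n y (FAnd (FAtom A) p)).
Proof.
move=> tp ar2 fvA e e0 k ee0.
have le2 : arity (tag A) <= 2 by rewrite ar2.
have tAp : transfers (FAnd (FAtom A) p).
  move=> f f0 l ff0.
  have ff0' x : f x = (f0 x, l) by apply: ff0; rewrite /= fvA in_setU inE.
  have eA := transfers_low_atom le2 (fun x _ => ff0' x).
  have ep := tp f f0 l (fun x _ => ff0' x).
  by split=> -[sA sp]; split; [exact/eA|exact/ep|exact/eA|exact/ep].
have [y' ny'] : exists y', y' != y.
  by case: y {ee0} => -[|[|//]] lty; [exists ord_max | exists ord0].
have ey x : x != y -> e x = (e0 x, k).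
  by move=> nx; apply: ee0; rewrite /= fvA !inE nx.
have upd d : eval (update e y (d, k)) (FAnd (FAtom A) p) <->
             eval (update e0 y d) (FAnd (FAtom A) p).
  by apply: (tAp _ _ k) => x _; rewrite /update; case: eqVneq => // /ey.
have in_copy d : eval (update e y d) (FAnd (FAtom A) p) -> d = (d.1, k).
  move=> /= [/(sat_low_atom _ le2)[_ [l el]] _].
  have := el y; have := el y'.
  rewrite fvA !inE /update eqxx (negbTE ny') ey //=.
  by move=> -> // /(_ isT) <-; exact: surjective_pairing.
split=> -[m [nm [g [inj_g sat_g]]]]; exists m; split=> //.
  exists (fun i => (g i).1); split; last first.
    by move=> i; apply/upd; rewrite -(in_copy _ (sat_g i)); exact: sat_g.
  move=> i j eij; apply: inj_g.
  by rewrite (in_copy _ (sat_g i)) (in_copy _ (sat_g j)) eij.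
exists (fun i => (g i, k)); split; first by move=> i j [/inj_g].
by move=> i; apply: (upd (g i)).2; exact: sat_g.
Qed.

Lemma GC2_transfers (phi : formula sg) : GC2 phi -> transfers phi.
Proof.
have split_fv (p1 p2 : formula sg) (e : 'I_2 -> dom unravelling)
    (e0 : 'I_2 -> dom M) (k : copy) :
    (forall x, x \in fv p1 :|: fv p2 -> e x = (e0 x, k)) ->
    (forall x, x \in fv p1 -> e x = (e0 x, k)) /\
    (forall x, x \in fv p2 -> e x = (e0 x, k)).
  by move=> H; split=> x xp; apply: H; rewrite inE xp ?orbT.
elim=> {phi} [A|p _ tp|p1 p2 _ tp1 _ tp2|p1 p2 _ tp1 _ tp2|p1 p2 _ tp1 _ tp2
             |xs A p _ tp le2 fvp|xs A p _ tp le2 fvp|n y A p _ tp|n y A p _ tp ar2 fvA].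
- exact: transfers_low_atom.
- exact: transfers_not.
- by move=> e e0 k /split_fv[/tp1 /= -> /tp2 ->].
- by move=> e e0 k /split_fv[/tp1 /= -> /tp2 ->].
- by move=> e e0 k /split_fv[/tp1 /= -> /tp2 ->].
- exact: transfers_exists_block.
- exact: transfers_forall_block.
- exact: transfers_at_least.
- exact: (transfers_not (@transfers_at_least n y A p tp ar2 fvA)).
Qed.

Lemma unravelling_formula (phi : formula sg) :
  GC2_constraint phi -> sat_formula M phi -> sat_formula unravelling phi.
Proof.
move=> [gphi fv0] sat_phi e.
apply/(GC2_transfers gphi (e0 := fun x => (e x).1) (k := [::])) => //.
by move=> x; rewrite fv0 inE.
Qed.

End Formulas.

End Unravelling.

Theorem proposition5p4 (sg : signature)
    (Sigma : seq (formula sg)) (Phi : seq (fd sg)) (Delta : seq (rule sg))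
    (F q : conj_atoms sg)
    (hSigma : forall phi, List.In phi Sigma -> GC2_constraint phi)
    (hPhi : forall f, f \in Phi -> 2 < arity (tag f))
    (hDelta : forall tau, List.In tau Delta ->
       [/\ single_head tau, frontier_one tau & non_conflicting Phi tau])
    (hI : exists I : interpretation sg,
       sat_theta Sigma Delta F q I /\
       exists W : structure sg, is_witness F I W /\ sat_fds W Phi) :
  exists J : interpretation sg, sat_theta Sigma Delta F q J /\ sat_fds J Phi.
Proof.
have [M [[_ satSigma satDelta no_q] [_ [[w satF ->] satW]]]] := hI.
exists (unravelling Phi Delta F w); split; last exact: unravelling_fds.
split.
- by exists (fun v => (w v, [::])); apply: sat_seed.
- by move=> phi phiS; apply: unravelling_formula; auto.
- by move=> tau tauD; apply: unravelling_rule => //; apply: satDelta.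
- move=> [e /(sat_conj_proj satF) sat_e]; apply: no_q.
  by exists (fun v => (e v).1).
Qed.
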